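(* Let $C\subset\mathbb{R}^{n+1}$ be a closed $(n+1)$-dimensional convex cone such that $0\in\partial C$ is a vertex of $C$. Then: (i) For any $x\in C\setminus\{0\}$ and $\mu>0$, we have $-x+C_x=-\mu x+C_{\mu x}$. Moreover, the set $-x+C_x$ is a closed convex cylinder. (ii) For any $x\in C\setminus\{0\}$, $-x+C_x$ is an asymptotic cylinder of $C$. (iii) Let $\{x_i\}_{i\in\mathbb{N}}$ be a divergent sequence in $\partial C$ such that $-x_i+C$ converges locally in Hausdorff distance to $K\in\mathcal{K}(C)$. Assume that $z_i:=|x_i|^{-1}x_i$ converges to $z$ and that $-x_i+C_{x_i}$ converges locally in Hausdorff distance to $K'$. Then $-z+C_z\subset K\subset K'$.
   Context: Here $n\ge1$. $C$ being a cone with vertex $0$ means $\lambda C\subset C$ for all $\lambda>0$. For $x\in C$, the tangent cone $C_x$ is the closure of $\bigcup_{\lambda>0}\{x+\lambda(y-x):y\in C\}$. A convex cylinder is the direct sum of a non-trivial linear subspace $V\subset\mathbb{R}^{n+1}$ and a closed convex set contained in a linear subspace orthogonal to $V$. A sequence $C_i$ of closed convex sets converges locally in Hausdorff distance to a closed convex set $K$ if, for every open ball $B$ with $K\cap B\ne\emptyset$, $C_i\cap\overline{B}$ converges to $K\cap\overline{B}$ in Hausdorff distance. A sequence $x_i$ is divergent if $|x_i|\to\infty$. $\mathcal{K}(C)$ is the set of asymptotic cylinders of $C$: all local Hausdorff limits of sequences $-x_i+C$ with $x_i\in C$ divergent. *)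

(* Defs.v *)
From HB Require Import structures.
From mathcomp Require Import all_boot all_order all_algebra.
From mathcomp Require Import all_classical all_reals all_analysis.

Set Implicit Arguments.
Unset Strict Implicit.
Unset Printing Implicit Defensive.

Import Order.TTheory GRing.Theory Num.Theory.
Import numFieldNormedType.Exports.

Local Open Scope classical_set_scope.
Local Open Scope ring_scope.

(* R^d is 'rV[R]_d.  The library norm on 'rV[R]_d is the sup norm; it induces
   the usual topology, so closure, interior and limits of vectors are the
   library's, but lengths and balls below are Euclidean. *)

Definition edot (R : realType) (d : nat) (u v : 'rV[R]_d) : R :=
  \sum_(i < d) u ord0 i * v ord0 i.

Definition enorm (R : realType) (d : nat) (u : 'rV[R]_d) : R :=
  Num.sqrt (edot u u).

Definition eball (R : realType) (d : nat) (p : 'rV[R]_d) (r : R) :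
    set 'rV[R]_d :=
  [set y | enorm (y - p) < r].

Definition boundary (T : topologicalType) (A : set T) : set T :=
  closure A `\` interior A.

Definition translate (R : realType) (d : nat) (v : 'rV[R]_d)
    (A : set 'rV[R]_d) : set 'rV[R]_d :=
  [set v + y | y in A].

(* Closed convex sets are taken to be nonempty: the empty set meets no ball, so
   it would otherwise be a local Hausdorff limit of every sequence. *)
Definition closed_convex (R : realType) (d : nat) (A : set 'rV[R]_d) : Prop :=
  [/\ A !=set0, closed A & @convex_set R 'rV[R]_d A].

Definition is_cone (R : realType) (d : nat) (C : set 'rV[R]_d) : Prop :=
  forall l : R, 0 < l -> [set l *: y | y in C] `<=` C.

Definition affine_hull (R : realType) (d : nat) (A : set 'rV[R]_d) :
    set 'rV[R]_d :=
  [set y | exists (k : nat) (p : 'I_k -> 'rV[R]_d) (a : 'I_k -> R),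
    [/\ forall i, A (p i), \sum_(i < k) a i = 1
      & y = \sum_(i < k) a i *: p i]].

Definition has_affine_dim (R : realType) (d : nat) (A : set 'rV[R]_d)
    (k : nat) : Prop :=
  exists (x : 'rV[R]_d) (V : {vspace 'rV[R]_d}),
    \dim V = k /\ affine_hull A = translate x [set` V].

Definition tangent_cone (R : realType) (d : nat) (C : set 'rV[R]_d)
    (x : 'rV[R]_d) : set 'rV[R]_d :=
  closure (\bigcup_(l in [set l : R | 0 < l]) [set x + l *: (y - x) | y in C]).

Definition convex_cylinder (R : realType) (d : nat) (A : set 'rV[R]_d) : Prop :=
  exists (V W : {vspace 'rV[R]_d}) (M : set 'rV[R]_d),
    [/\ V != 0%VS,
        {in V & W, forall v w, edot v w = 0},
        closed_convex M,
        M `<=` [set` W]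
      & A = [set v + m | v in [set` V] & m in M]].

Definition ethickening (R : realType) (d : nat) (A : set 'rV[R]_d) (r : R) :
    set 'rV[R]_d :=
  [set y | exists2 a, A a & enorm (y - a) <= r].

(* Extended-real valued, so that the distance from a nonempty set to the empty
   set is +oo. *)
Definition hausdorff_dist (R : realType) (d : nat) (A B : set 'rV[R]_d) :
    \bar R :=
  ereal_inf [set r%:E | r in [set r : R |
    [/\ 0 <= r, A `<=` ethickening B r & B `<=` ethickening A r]]].

Definition local_hausdorff_cvg (R : realType) (d : nat)
    (C : nat -> set 'rV[R]_d) (K : set 'rV[R]_d) : Prop :=
  [/\ forall i, closed_convex (C i),
      closed_convex K
    & forall (p : 'rV[R]_d) (r : R), K `&` eball p r !=set0 ->
        hausdorff_dist (C i `&` closure (eball p r))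
                       (K `&` closure (eball p r)) @[i --> \oo] --> 0%E].

Definition divergent (R : realType) (d : nat) (x : nat -> 'rV[R]_d) : Prop :=
  enorm (x i) @[i --> \oo] --> +oo.

Definition asymptotic_cylinders (R : realType) (d : nat) (C : set 'rV[R]_d) :
    set (set 'rV[R]_d) :=
  [set K | exists x : nat -> 'rV[R]_d,
    [/\ forall i, C (x i), divergent x
      & local_hausdorff_cvg (fun i => translate (- x i) C) K]].

(* Main.v *)
(* For x in a closed convex cone C one has -x + C_x = closure (C + R x), which
   gives (i): this set is invariant under translation by R x, hence splits
   along R x and its orthogonal complement.  The sets -i x + C increase with i
   and their union is C + R x; an increasing sequence of closed convex sets
   converges locally to the closure of its union, which gives (ii).  For (iii),
   a local Hausdorff limit K of A_i consists exactly of the points to which the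
   distance of A_i tends to 0.  If y is in C and |x_i| >= l, then
   y - l z_i = (y + (|x_i| - l) z_i) - x_i lies in -x_i + C, and it tends to
   y - l z; the other inclusion follows from -x_i + C being contained in
   -x_i + C_{x_i}. *)
Require Import Defs.
From mathcomp Require Import all_boot all_order all_algebra.
From mathcomp Require Import all_classical all_reals all_analysis.
From mathcomp Require Import ring lra.

Set Implicit Arguments.
Unset Strict Implicit.
Unset Printing Implicit Defensive.

Import Order.TTheory GRing.Theory Num.Theory.
Import numFieldNormedType.Exports.
Local Open Scope classical_set_scope.
Local Open Scope ring_scope.

(** * Euclidean length, and its link to the library topology and to convexity *)

Section Euclidean.
Variables (R : realType) (d : nat).
Implicit Types (u v w p : 'rV[R]_d) (A B : set 'rV[R]_d).

Lemma edotC u v : edot u v = edot v u.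
Proof. by apply: eq_bigr => i _; rewrite mulrC. Qed.

Lemma edotDl u v w : edot (u + v) w = edot u w + edot v w.
Proof. by rewrite /edot -big_split; apply: eq_bigr => i _; rewrite mxE mulrDl. Qed.

Lemma edotZl (a : R) u v : edot (a *: u) v = a * edot u v.
Proof. by rewrite /edot mulr_sumr; apply: eq_bigr => i _; rewrite mxE mulrA. Qed.

Lemma edot_ge0 u : 0 <= edot u u.
Proof. by apply: sumr_ge0 => i _; rewrite -expr2 sqr_ge0. Qed.

Lemma edot_gt0 u : u != 0 -> 0 < edot u u.
Proof.
move=> u0; rewrite lt_def edot_ge0 andbT; apply: contra u0.
rewrite psumr_eq0 => [/allP u0|i _]; last by rewrite -expr2 sqr_ge0.
apply/eqP/rowP => i; rewrite mxE; apply/eqP.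
by have := u0 i (mem_index_enum i); rewrite /= mulf_eq0 orbb.
Qed.

Lemma cauchy_schwarz u v : edot u v ^+ 2 <= edot u u * edot v v.
Proof.
have [->|/edot_gt0 v0] := eqVneq v 0.
  by rewrite edotC -(scale0r 0) !edotZl !mul0r mulr0 expr0n.
(* This vector is [edot v v] times the component of [u] orthogonal to [v]; its squared length is
   [c * (a * c - b ^+ 2)]. *)
have := edot_ge0 (edot v v *: u + - edot u v *: v).
rewrite edotDl !(edotZl, edotC _ (_ + _)) !edotDl !edotZl (edotC v u).
set a := edot u u; set b := edot u v; set c := edot v v => H.
suff : 0 <= c * (a * c - b ^+ 2) by rewrite pmulr_rge0// subr_ge0.
by apply: le_trans H _; rewrite le_eqVlt; apply/orP; left; apply/eqP; ring.
Qed.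

Lemma enorm_ge0 u : 0 <= enorm u.
Proof. exact: sqrtr_ge0. Qed.

Lemma enorm0 : enorm (0 : 'rV[R]_d) = 0.
Proof. by rewrite /enorm /edot big1 ?sqrtr0// => i _; rewrite mxE mul0r. Qed.

Lemma enorm_gt0 u : u != 0 -> 0 < enorm u.
Proof. by move=> u0; rewrite sqrtr_gt0 edot_gt0. Qed.

Lemma enormZ (a : R) u : enorm (a *: u) = `|a| * enorm u.
Proof.
by rewrite /enorm edotZl edotC edotZl mulrA -expr2 sqrtrM ?sqr_ge0// sqrtr_sqr.
Qed.

Lemma enormN u : enorm (- u) = enorm u.
Proof. by rewrite -scaleN1r enormZ normrN1 mul1r. Qed.

Lemma enormC u v : enorm (u - v) = enorm (v - u).
Proof. by rewrite -enormN opprB. Qed.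

Lemma enormD u v : enorm (u + v) <= enorm u + enorm v.
Proof.
rewrite -[leRHS]ger0_norm ?addr_ge0 ?enorm_ge0// -sqrtr_sqr.
apply: ler_wsqrtr.
rewrite sqrrD !sqr_sqrtr ?edot_ge0// edotDl !(edotC _ (u + v)) !edotDl (edotC v u).
have : edot u v <= enorm u * enorm v.
  rewrite /enorm -sqrtrM ?edot_ge0//; apply: le_trans (ler_norm _) _.
  by rewrite -sqrtr_sqr; exact/ler_wsqrtr/cauchy_schwarz.
by rewrite /enorm mulr2n; lra.
Qed.

(** With the continuity of [enorm], this bound makes Euclidean balls a neighbourhood basis of the
    sup-norm topology, so closures can be tested with [enorm]. *)
Lemma norm_le_enorm u : `|u| <= enorm u.
Proof.
rewrite [`|u|]mx_normrE; apply: bigmax_le => [|[i j] _] /=; first exact: enorm_ge0.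
rewrite (ord1 i) -sqrtr_sqr; apply: ler_wsqrtr.
rewrite /edot (bigD1 j)//= expr2 lerDl.
by apply: sumr_ge0 => k _; rewrite -expr2 sqr_ge0.
Qed.

Lemma continuous_edot (T : topologicalType) (f g : T -> 'rV[R]_d) :
  continuous f -> continuous g -> continuous (fun t => edot (f t) (g t)).
Proof.
move=> cf cg.
apply: (@continuous_big R^o _ +%R 0 xpredT _ T _
  (fun i t => f t ord0 i * g t ord0 i)) => [|i _ t].
  exact: add_continuous.
have coord (h : T -> 'rV[R]_d) : continuous h -> h s ord0 i @[s --> t] --> h t ord0 i.
  move=> ch; apply: (@continuous_comp T 'rV[R]_d R h (fun v => v ord0 i)).
    exact: ch.
  exact: (@coord_continuous R 1 d ord0 i).
by apply: (@cvgM R T (nbhs t) _ (fun s => f s ord0 i) (fun s => g s ord0 i));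
  exact: coord.
Qed.

Lemma enorm_continuous : continuous (@enorm R d).
Proof.
move=> u; apply: continuous_comp; last exact: sqrt_continuous.
by apply: continuous_edot => v; exact: cvg_id.
Qed.

Lemma continuous_affine (a : R) w : continuous (fun u => a *: u + w).
Proof.
move=> u; apply: (@cvgD _ 'rV[R]_d _ (nbhs u) _ ( *:%R a) (fun=> w)).
  exact: scaler_continuous.
exact: cvg_cst.
Qed.

Lemma open_enorm_lt u (e : R) : open [set v | enorm (v - u) < e].
Proof.
apply: (@open_comp _ _ (fun v => enorm (v - u)) [set t | t < e]) => [v _|]; last exact: open_lt.
apply: continuous_comp; last exact: enorm_continuous.
have := @continuous_affine 1 (- u) v.
by rewrite (_ : (fun w => _) = (fun w => w - u)) //; apply/funext => w; rewrite scale1r.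
Qed.

Lemma closureP_enorm A u :
  closure A u <-> forall e, 0 < e -> exists2 a, A a & enorm (a - u) < e.
Proof.
split=> [Au e e0|H B /nbhs_ballP[e /= e0 eB]].
  have /Au[a [Aa ae]] : nbhs u [set v | enorm (v - u) < e].
    by apply: open_nbhs_nbhs; split; [exact: open_enorm_lt|rewrite /= subrr enorm0].
  by exists a.
have [a Aa au] := H e e0; exists a; split => //; apply: eB.
rewrite -ball_normE /ball_ /=; apply: le_lt_trans au.
by rewrite distrC norm_le_enorm.
Qed.

Lemma closure_continuous (f : 'rV[R]_d -> 'rV[R]_d) A B :
  continuous f -> (forall u, A u -> closure B (f u)) ->
  forall u, closure A u -> closure B (f u).
Proof.
move=> cf AB u; rewrite closureE => /(_ (f @^-1` closure B)); apply; split => //.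
by move/continuous_closedP : cf; apply; exact: closed_closure.
Qed.

Lemma closure_eball_sub p (r : R) : closure (eball p r) `<=` [set y | enorm (y - p) <= r].
Proof.
move=> y /closureP_enorm yp /=; apply/ler_addgt0Pr => e e0.
have [a /= ap /ltW ay] := yp e e0.
have -> : y - p = (a - p) + (y - a) by rewrite [RHS]addrC subrKA.
apply: le_trans (enormD _ _) _.
by rewrite (enormC y) lerD// ltW.
Qed.

Lemma compact_closure_eball p (r : R) : compact (closure (eball p r)).
Proof.
apply: bounded_closed_compact; last exact: closed_closure.
exists (r + `|p|); split=> [|M /ltW rM y /closure_eball_sub /= yp]; first exact: num_real.
apply: le_trans rM.
rewrite -[y](subrK p); apply: (le_trans (ler_normD _ _)).
by rewrite lerD2r; apply: le_trans yp; exact: norm_le_enorm.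
Qed.

Lemma convex_setP A : @convex_set R 'rV[R]_d A <->
  forall u v (t : R), 0 <= t <= 1 -> A u -> A v -> A (t *: u + (1 - t) *: v).
Proof.
split=> [cA u v t /andP[t0 t1] Au Av|cA u v t].
  by have := cA u v (Itv01 t0 t1); rewrite !inE; apply.
rewrite !inE => Au Av; apply: (cA u v t%:num) => //.
by apply/andP; split.
Qed.

Lemma convex_closure A :
  @convex_set R 'rV[R]_d A -> @convex_set R 'rV[R]_d (closure A).
Proof.
move=> /convex_setP cA; apply/convex_setP => u v t t01 Au Av.
(* The two points pass to the closure one at a time, each through an affine map in that variable
   alone. *)
apply: (closure_continuous (f := fun u => t *: u + (1 - t) *: v)) Au.
  exact: continuous_affine.
move=> {}u Au; rewrite addrC.
apply: (closure_continuous (f := fun v => (1 - t) *: v + t *: u)) Av.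
  exact: continuous_affine.
by move=> {}v Av; apply: subset_closure; rewrite addrC; exact: cA.
Qed.

End Euclidean.

(** * Local Hausdorff limits described pointwise *)

Section Hausdorff.
Variables (R : realType) (d : nat).
Implicit Types (u v : 'rV[R]_d) (A B : nat -> set 'rV[R]_d) (K : set 'rV[R]_d).

Lemma hausdorff_cvg0P A B :
  hausdorff_dist (A i) (B i) @[i --> \oo] --> 0%E <->
  forall e : R, 0 < e -> \forall i \near \oo,
    A i `<=` ethickening (B i) e /\ B i `<=` ethickening (A i) e.
Proof.
split=> [AB e e0|AB].
  have : \forall i \near \oo, (hausdorff_dist (A i) (B i) < e%:E)%E.
    have /AB : nbhs (0 : \bar R)%E (fun x => x < e%:E)%E.
      by apply: open_ereal_lt'; rewrite lte_fin.
    by [].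
  apply: filterS => i /ereal_inf_lt[_ [r [r0 rA rB] <-]]; rewrite lte_fin => re.
  by split=> y => [/rA|/rB] [a ? /le_trans ya]; exists a => //; apply/ya/ltW.
have hd_ge0 i : (0 <= hausdorff_dist (A i) (B i))%E.
  by apply: le_ereal_inf_tmp => _ [r [r0 _ _] <-]; rewrite lee_fin.
have hd_le (e : R) : 0 < e -> \forall i \near \oo, (hausdorff_dist (A i) (B i) <= e%:E)%E.
  move=> e0; apply: filterS (AB e e0) => i [ABi BAi].
  by apply: ereal_inf_lbound; exists e => //; split => //; exact: ltW.
apply/fine_cvgP; split.
  apply: filterS (hd_le 1 ltr01) => i h1.
  by rewrite ge0_fin_numE// (le_lt_trans h1)// ltry.
apply/cvgrPdist_le => e e0; apply: filterS (hd_le e e0) => i he.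
rewrite sub0r normrN /= ger0_norm ?fine_ge0//.
by rewrite -lee_fin fineK// ge0_fin_numE// (le_lt_trans he)// ltry.
Unshelve. all: by end_near. Qed.

(** The criterion mentions no balls, so inclusions between limits can be checked point by point. *)
Lemma local_hausdorff_cvg_limP A K u : local_hausdorff_cvg A K ->
  K u <-> forall e : R, 0 < e ->
            \forall i \near \oo, exists2 a, A i a & enorm (a - u) < e.
Proof.
move=> [_ [[k0 Kk0] Kcl _] AK]; split=> [Ku|H].
  move=> e e0; have [e2 e2e] : 0 < e / 2 /\ e / 2 < e by split; lra.
  have uu (r : R) : 0 < r -> eball u r u by rewrite /eball/= subrr enorm0.
  have /AK/hausdorff_cvg0P/(_ _ e2) : K `&` eball u 1 !=set0.
    by exists u; split => //; exact: uu.
  apply: filterS => i [_ /(_ u)[|a [Aa _] ua]].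
    by split => //; apply/subset_closure/uu.
  by exists a => //; rewrite enormC (le_lt_trans ua).
apply: Kcl; apply/closureP_enorm => e e0.
have [e2 e2e] : 0 < e / 2 /\ e / 2 < e by split; lra.
(* The ball about [u] must contain [k0], so that convergence applies to it, and all points within
   [e / 2] of [u], so that it catches [a]. *)
pose r := enorm (k0 - u) + e.
have r0 : e / 2 < r by rewrite (lt_le_trans e2e)// lerDr enorm_ge0.
have /AK/hausdorff_cvg0P/(_ _ e2) : K `&` eball u r !=set0.
  by exists k0; split => //; rewrite /eball/= ltrDl.
move=> /(filterI (H _ e2))/filter_ex[i [[a Aa au] [/(_ a) AKa _]]].
have [|k [Kk _] ak] := AKa.
  by split => //; apply: subset_closure; exact: lt_trans au r0.
exists k => //; have -> : k - u = (k - a) + (a - u) by rewrite subrKA.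
apply: le_lt_trans (enormD _ _) _.
by rewrite [ltRHS]splitr enormC ler_ltD.
Qed.

End Hausdorff.

(** * Tangent cones of a closed convex cone and their splitting *)

Section Cones.
Variables (R : realType) (d : nat).
Implicit Types (u v w x y : 'rV[R]_d) (A C : set 'rV[R]_d).

Lemma translateP v A u : translate (- v) A u <-> A (u + v).
Proof.
split=> [[y Ay <-]|Auv]; first by rewrite addrC addNKr.
by exists (u + v) => //; rewrite addrC addrK.
Qed.

Lemma closed_convex_translate v A :
  closed_convex A -> closed_convex (translate (- v) A).
Proof.
move=> [[a Aa] Acl /convex_setP Acv]; split.
- by exists (a - v); apply/translateP; rewrite subrK.
- have -> : translate (- v) A = (fun u => 1 *: u + v) @^-1` A.
    by apply/seteqP; split=> u; rewrite /= scale1r => /translateP.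
  by have /continuous_closedP := @continuous_affine R d 1 v; exact.
- apply/convex_setP => u w t t01 /translateP Au /translateP Aw.
  apply/translateP; have := Acv _ _ _ t01 Au Aw.
  by congr A; rewrite !scalerDr addrACA -scalerDl subrKC scale1r.
Qed.

(* This is C + R x. *)
Definition dirs C x : set 'rV[R]_d := [set u | exists l : R, C (u + l *: x)].

Lemma dirsZ C x (m : R) : m != 0 -> dirs C (m *: x) = dirs C x.
Proof.
move=> m0; apply/seteqP; split=> u [l Cl].
  by exists (l * m); rewrite -scalerA.
by exists (l / m); rewrite scalerA divfK.
Qed.

Variable C : set 'rV[R]_d.
Hypotheses (C_convex : closed_convex C) (C_cone : is_cone C).

Lemma cone_add u v : C u -> C v -> C (u + v).
Proof.
have [_ _ /convex_setP cC] := C_convex => Cu Cv.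
have h : 0 <= (2^-1 : R) <= 1 by apply/andP; split; lra.
have := cC _ _ _ h Cu Cv.
have -> : (1 - 2^-1 : R) = 2^-1 by lra.
(* [u + v] is twice the midpoint, which lies in [C] by convexity. *)
move=> Cuv; apply: (@C_cone 2) => //; exists (2^-1 *: u + 2^-1 *: v) => //.
by rewrite -scalerDr scalerA divff// scale1r.
Qed.

Lemma cone0 : C 0.
Proof.
have [[a Ca] Ccl _] := C_convex; apply: Ccl; apply/closureP_enorm => e e0.
have n0 : 0 < enorm a + 1 by rewrite ltr_wpDl ?enorm_ge0.
(* Positive multiples of [a] shrink to 0; the [+ 1] keeps the denominator positive when [a = 0]. *)
exists (e / (enorm a + 1) *: a).
  by apply: (@C_cone (e / (enorm a + 1))); [rewrite /= divr_gt0|exists a].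
rewrite subr0 enormZ gtr0_norm ?divr_gt0// mulrAC ltr_pdivrMr//.
by rewrite ltr_pM2l// ltrDl.
Qed.

Lemma cone_scale (l : R) u : 0 <= l -> C u -> C (l *: u).
Proof.
rewrite le_eqVlt => /predU1P[<- _|l0 Cu]; first by rewrite scale0r; exact: cone0.
by apply: (C_cone l0); exists u.
Qed.

(** Translated by [- x], the point [x + l *: (y - x)] becomes [l *: y - l *: x], and [l *: y] is
    again in the cone. [TE] records this before closures are taken, and translation commutes with
    closure. *)
Lemma tangent_cone_dirs x : C x ->
  translate (- x) (tangent_cone C x) = closure (dirs C x).
Proof.
move=> Cx.
have TE u : (\bigcup_(l in [set l : R | 0 < l]) [set x + l *: (y - x) | y in C]) u
    <-> dirs C x (u - x).
  split=> [[l l0 [y Cy <-]]|[l Cl]].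
    exists l; rewrite (addrC x) addrK scalerBr subrK.
    by apply: cone_scale => //; exact: ltW.
  (* The given [l] may be nonpositive. It can be raised to a positive [m], since adding
     [(m - l) *: x] stays in [C]. *)
  pose m := `|l| + 1.
  have m0 : 0 < m by rewrite ltr_wpDl.
  exists m => //; exists (m^-1 *: (u - x + m *: x)).
    apply: cone_scale; first by rewrite invr_ge0 ltW.
    have -> : u - x + m *: x = (u - x + l *: x) + (m - l) *: x.
      by rewrite -[RHS]addrA -scalerDl subrKC.
    apply: cone_add => //; apply: cone_scale => //.
    by rewrite subr_ge0 /m (le_trans (ler_norm l))// lerDl.
  rewrite scalerBr scalerA divff ?gt_eqF// scale1r addrK.
  by rewrite subrKC.
apply/seteqP; split=> u.
  move/translateP => Tu.
  have -> : u = 1 *: (u + x) - x by rewrite scale1r addrK.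
  apply: (@closure_continuous _ _ (fun v => 1 *: v - x)) Tu.
    exact: continuous_affine.
  by move=> v /TE; rewrite scale1r; exact: subset_closure.
move=> Du; apply/translateP; rewrite -[u]scale1r.
apply: (@closure_continuous _ _ (fun v => 1 *: v + x)) Du.
  exact: continuous_affine.
by move=> v Dv; apply/subset_closure/TE; rewrite scale1r addrK.
Qed.

Lemma closed_convex_dirs x : C x -> closed_convex (closure (dirs C x)).
Proof.
have [_ _ /convex_setP cC] := C_convex => Cx.
split; [|exact: closed_closure|].
  by exists 0; apply: subset_closure; exists 1; rewrite add0r scale1r.
apply: convex_closure; apply/convex_setP => u v t t01 [l Cl] [m Cm].
exists (t * l + (1 - t) * m); have := cC _ _ _ t01 Cl Cm.
by congr C; rewrite !scalerDr !scalerA addrACA -scalerDl.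
Qed.

Lemma closure_dirsD x u (l : R) :
  closure (dirs C x) u -> closure (dirs C x) (u + l *: x).
Proof.
move=> Du; rewrite -[u]scale1r.
apply: (@closure_continuous _ _ (fun v => 1 *: v + l *: x)) Du.
  exact: continuous_affine.
move=> v [m Cm]; apply: subset_closure; exists (m - l).
by rewrite scale1r -addrA -scalerDl subrKC.
Qed.

Lemma convex_cylinder_dirs x : C x -> x != 0 ->
  convex_cylinder (closure (dirs C x)).
Proof.
move=> Cx x0; have [[a Da] Dcl /convex_setP Dcv] := closed_convex_dirs Cx.
(* The orthogonal complement of [x], as the kernel of the inner product with [x]; [pr] below is the
   orthogonal projection onto it. *)
pose W := lker (linfun (mulmxr x^T : 'rV[R]_d -> 'rV[R]_1)).
have WP u : u \in W <-> edot u x = 0.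
  rewrite memv_ker lfunE /=; split => [/eqP/rowP/(_ ord0)|ux].
    by rewrite !mxE => <-; apply: eq_bigr => i _; rewrite mxE.
  apply/eqP/rowP => i; rewrite !mxE -[RHS]ux.
  by apply: eq_bigr => j _; rewrite mxE (ord1 i).
pose pr u := u - edot u x / edot x x *: x.
have prP u : edot (pr u) x = 0.
  by rewrite /pr -scaleNr edotDl edotZl mulNr divfK ?subrr// gt_eqF ?edot_gt0.
(* The base is the slice by [W]. Projecting by [pr] only moves a point along [x], so it stays in the
   set. *)
exists <[x]>%VS, W, (closure (dirs C x) `&` [set u | edot u x = 0]); split.
- by rewrite -memv0 in x0 *; apply: contra x0 => /eqP <-; exact: memv_line.
- by move=> v w /vlineP[k ->] /WP wx; rewrite edotZl edotC wx mulr0.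
- split.
  + exists (pr a); split => //.
    by rewrite /pr -scaleNr; exact: closure_dirsD.
  + apply: closedI => //.
    apply: (@preimage_closed _ _ (fun u => edot u x) [set 0]) => [u _|].
      apply: continuous_edot => v; [exact: cvg_id|exact: cst_continuous].
    exact: closed_eq.
  + apply/convex_setP => u v t t01 [Du ux] [Dv vx]; split; first exact: Dcv.
    by rewrite /= edotDl !edotZl ux vx !mulr0 addr0.
- by move=> u [_ /WP].
- apply/seteqP; split=> [u Du|_ [_ /vlineP[k ->]] [m [Dm _]] <-].
    exists (edot u x / edot x x *: x); first by apply/vlineP; eexists.
    exists (pr u); last by rewrite /pr subrKC.
    by split => //; rewrite /pr -scaleNr; exact: closure_dirsD.
  by rewrite addrC; exact: closure_dirsD.
Qed.

End Cones.

(** * Increasing sequences of convex sets *)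

(** A Dini-type argument: near each point of the compact set [closure U] within the closed ball, a
    single point of some [A i] serves as approximation, monotonicity keeps it available for later
    indices, and compactness makes the index uniform. *)
Lemma local_hausdorff_cvg_bigcup (R : realType) (d : nat)
    (A : nat -> set 'rV[R]_d) :
  (forall i, closed_convex (A i)) ->
  (forall i j, (i <= j)%N -> A i `<=` A j) ->
  local_hausdorff_cvg A (closure (\bigcup_i A i)).
Proof.
move=> Acc Amono; pose U := \bigcup_i A i.
have Ucv : @convex_set R 'rV[R]_d U.
  apply/convex_setP => u v t t01 [i _ Au] [j _ Av].
  have [_ _ /convex_setP Acv] := Acc (maxn i j).
  by exists (maxn i j) => //; apply: Acv => //;
    [apply: Amono Au; exact: leq_maxl|apply: Amono Av; exact: leq_maxr].
have /convex_setP Kcv := convex_closure Ucv.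
split=> [//||p r [q [Kq /= qr]]].
  split; [|exact: closed_closure|exact/convex_setP].
  by have [[a Aa] _ _] := Acc 0%N; exists a; apply: subset_closure; exists 0%N.
apply/hausdorff_cvg0P => e e0.
have /compact_near_coveringP cov : compact (closure U `&` closure (eball p r)).
  apply: (subclosed_compact _ (@compact_closure_eball _ _ p r)); last by move=> y [].
  by apply: closedI; exact: closed_closure.
have : \forall i \near \oo, closure U `&` closure (eball p r) `<=`
    ethickening (A i `&` closure (eball p r)) e.
  apply: (cov _ _ (fun i => ethickening (A i `&` closure (eball p r)) e)) => a [Ka ar].
  suff [i [c [[Ac cr] ac]]] : exists i c, (A i `&` closure (eball p r)) c /\ enorm (a - c) < e.
    exists ([set b | enorm (b - c) < e], [set j | (i <= j)%N]).
      split=> /=; last by exists i.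
      by apply: open_nbhs_nbhs; split; [exact: open_enorm_lt|].
    move=> [b j] /= [bc ij]; exists c; last exact: ltW.
    by split => //; exact: Amono Ac.
  (* Moving [a] slightly towards the point [q] of the open ball brings it
     inside the open ball, where it can be approximated from [U]. *)
  have apr := closure_eball_sub ar.
  (* Chosen so that [s < 1] and [s * enorm (q - a) < e / 2]. *)
  pose s := e / (2 * (enorm (q - a) + e)).
  have qa0 := enorm_ge0 (q - a).
  have s0 : 0 < s by rewrite divr_gt0//; lra.
  have s1 : s < 1 by rewrite ltr_pdivrMr; lra.
  pose b := s *: q + (1 - s) *: a.
  have Kb : closure U b by apply: Kcv => //; rewrite !ltW.
  have br : enorm (b - p) < r.
    have -> : b - p = s *: (q - p) + (1 - s) *: (a - p).
      by apply/rowP => i; rewrite !mxE; ring.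
    apply: le_lt_trans (enormD _ _) _; rewrite !enormZ !gtr0_norm ?subr_gt0//.
    have -> : r = s * r + (1 - s) * r by ring.
    by rewrite ltr_leD// ?ltr_pM2l// ler_wpM2l// subr_ge0 ltW.
  have ab : enorm (a - b) < e / 2.
    have -> : a - b = s *: (a - q).
      by apply/rowP => i; rewrite !mxE; ring.
    rewrite enormZ gtr0_norm// enormC /s mulrAC ltr_pdivrMr; last by lra.
    by nra.
  (* Within [f] of [b], a point is less than [e] from [a] and still inside the open ball. *)
  pose f := Num.min (e / 2) (r - enorm (b - p)).
  have f0 : 0 < f by rewrite lt_min; lra.
  have /closureP_enorm/(_ f f0)[c [i _ Ac] cb] := Kb.
  move: cb; rewrite lt_min => /andP[cb1 cb2].
  exists i, c; split; first split => //.
    apply: subset_closure; rewrite /eball/=.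
    have -> : c - p = (c - b) + (b - p) by rewrite subrKA.
    by apply: le_lt_trans (enormD _ _) _; lra.
  have -> : a - c = (a - b) + (b - c) by rewrite subrKA.
  by apply: le_lt_trans (enormD _ _) _; rewrite (enormC b); lra.
apply: filterS => i KA; split=> // a [Aa ar]; exists a.
  by split => //; apply: subset_closure; exists i.
by rewrite subrr enorm0 ltW.
Qed.

(** * Asymptotic cylinders of the cone *)

Section Asymptotics.
Variables (R : realType) (d : nat) (C : set 'rV[R]_d).
Hypotheses (C_convex : closed_convex C) (C_cone : is_cone C).
Implicit Types (u v w x y : 'rV[R]_d).

Lemma local_hausdorff_cvg_dirs x : C x ->
  local_hausdorff_cvg (fun i => translate (- (i%:R *: x)) C) (closure (dirs C x)).
Proof.
move=> Cx.
have mono (l m : R) u : l <= m -> C (u + l *: x) -> C (u + m *: x).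
  move=> lm Cl; rewrite -(subrKC l m) scalerDl addrA.
  by apply: cone_add => //; apply: cone_scale => //; rewrite subr_ge0.
have -> : dirs C x = \bigcup_i translate (- (i%:R *: x)) C.
  apply/seteqP; split=> u [l]; last by move=> _ /translateP; exists l%:R.
  (* Any natural number above [l] will do, since [mono] lets the multiple of [x] grow. *)
  move=> Cl; exists (Num.trunc `|l|).+1 => //; apply/translateP.
  apply: mono Cl; apply: le_trans (ler_norm _) _; apply/ltW.
  by rewrite truncnS_gt.
apply: local_hausdorff_cvg_bigcup => [i|i j ij u /translateP Cu].
  exact: closed_convex_translate.
by apply/translateP; apply: mono Cu; rewrite ler_nat.
Qed.

Lemma asymptotic_cylinder_dirs x : C x -> x != 0 ->
  asymptotic_cylinders C (closure (dirs C x)).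
Proof.
move=> Cx x0; exists (fun i => i%:R *: x); split.
- by move=> i; apply: cone_scale.
- apply/cvgryPge => a.
  have /cvgryPge/(_ (a / enorm x)) := @cvgr_idn R.
  by apply: filterS => i; rewrite ler_pdivrMr ?enorm_gt0// enormZ normr_nat.
- exact: local_hausdorff_cvg_dirs.
Qed.

Lemma closure_dirs_sub_cylinder (x : nat -> 'rV[R]_d) z (K : set 'rV[R]_d) :
  (forall i, C (x i)) -> divergent x ->
  local_hausdorff_cvg (fun i => translate (- x i) C) K ->
  (enorm (x i))^-1 *: x i @[i --> \oo] --> z ->
  closure (dirs C z) `<=` K.
Proof.
move=> Cx xoo xK xz; have [_ [_ Kcl _] _] := xK.
apply: (@subset_trans _ (closure K)) => //; apply: closure_subset => u [l Cu].
apply/(local_hausdorff_cvg_limP _ xK) => e e0.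
have zlim : enorm ((- l) *: ((enorm (x i))^-1 *: x i) + l *: z) @[i --> \oo] --> (0 : R).
  have cf : continuous (fun v => enorm ((- l) *: v + l *: z)).
    move=> v; apply: continuous_comp; last exact: enorm_continuous.
    exact: continuous_affine.
  have <- : enorm ((- l) *: z + l *: z) = 0 by rewrite scaleNr addNr enorm0.
  exact: (continuous_cvg _ (cf z) xz).
have /cvgrPdist_lt/(_ e e0) := zlim.
(* The absolute value also forces [enorm (x i)] to be positive when [l] is negative. *)
have /cvgryPgt/(_ `|l|) := xoo.
apply: filterS2 => i xl; rewrite sub0r normrN ger0_norm ?enorm_ge0// => zi_e.
have x0 : 0 < enorm (x i) by apply: le_lt_trans xl.
(* With [y = u + l *: z] in [C], this is [y] minus [l] times the normalised [x i]; its difference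
   from [u] is the vector shown small in [zlim]. *)
exists (u + ((- l) *: ((enorm (x i))^-1 *: x i) + l *: z)); last by rewrite addrC addKr.
apply/translateP.
have -> : u + ((- l) *: ((enorm (x i))^-1 *: x i) + l *: z) + x i =
    (u + l *: z) + (1 - l / enorm (x i)) *: x i.
  by apply/rowP => k; rewrite !mxE; ring.
apply: cone_add => //; apply: cone_scale => //.
rewrite subr_ge0 ler_pdivrMr// mul1r ltW//; exact: le_lt_trans (ler_norm _) xl.
Qed.

Lemma local_hausdorff_limit_sub (A B : nat -> set 'rV[R]_d) (K L : set 'rV[R]_d) :
  (forall i, A i `<=` B i) ->
  local_hausdorff_cvg A K -> local_hausdorff_cvg B L -> K `<=` L.
Proof.
move=> AB AK BL u /(local_hausdorff_cvg_limP _ AK) Ku.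
apply/(local_hausdorff_cvg_limP _ BL) => e /Ku; apply: filterS => i [a Aa au].
by exists a => //; exact: AB.
Qed.

End Asymptotics.

Theorem proposition3p30 (R : realType) (n : nat) (hn : (1 <= n)%N)
    (C : set 'rV[R]_n.+1)
    (C_closed_convex : closed_convex C)
    (C_dim : has_affine_dim C n.+1)
    (C_cone : is_cone C)
    (C_vertex : boundary C 0) :
  (* (i) *)
  (forall x : 'rV[R]_n.+1, C x -> x <> 0 ->
    (forall mu : R, 0 < mu ->
      translate (- x) (tangent_cone C x)
      = translate (- (mu *: x)) (tangent_cone C (mu *: x)))
    /\ closed_convex (translate (- x) (tangent_cone C x))
    /\ convex_cylinder (translate (- x) (tangent_cone C x)))
  /\
  (* (ii) *)
  (forall x : 'rV[R]_n.+1, C x -> x <> 0 ->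
    asymptotic_cylinders C (translate (- x) (tangent_cone C x)))
  /\
  (* (iii) *)
  (forall (x : nat -> 'rV[R]_n.+1) (z : 'rV[R]_n.+1) (K K' : set 'rV[R]_n.+1),
    (forall i, boundary C (x i)) ->
    divergent x ->
    asymptotic_cylinders C K ->
    local_hausdorff_cvg (fun i => translate (- x i) C) K ->
    (enorm (x i))^-1 *: x i @[i --> \oo] --> z ->
    local_hausdorff_cvg
      (fun i => translate (- x i) (tangent_cone C (x i))) K' ->
    translate (- z) (tangent_cone C z) `<=` K /\ K `<=` K').
Proof.
have Ccl : forall y, closure C y -> C y by have [_ Ccl _] := C_closed_convex.
split; [|split].
- move=> x Cx /eqP x0; split=> [mu mu0|].
    rewrite !tangent_cone_dirs ?dirsZ ?gt_eqF//.
    by apply: cone_scale => //; exact: ltW.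
  rewrite tangent_cone_dirs//; split; first exact: closed_convex_dirs.
  exact: convex_cylinder_dirs.
- move=> x Cx /eqP x0; rewrite tangent_cone_dirs//.
  exact: asymptotic_cylinder_dirs.
- move=> x z K K' bx xoo _ xK xz xK'.
  have Cx i : C (x i) by have [/Ccl] := bx i.
  have Cz : C z.
    apply: Ccl; apply: (closed_cvg (closure C)) xz; first exact: closed_closure.
    near=> i; apply: subset_closure.
    (* If [x i = 0] the inverse is 0 by convention; [cone_scale] allows the factor 0. *)
    by apply: cone_scale => //; rewrite invr_ge0 enorm_ge0.
  split; first by rewrite tangent_cone_dirs//; exact: closure_dirs_sub_cylinder xK xz.
  apply: local_hausdorff_limit_sub xK xK' => i.
  rewrite tangent_cone_dirs// => u /translateP Cu.
  (* The coefficient 1 witnesses that the translate of [C] by [- x i] lies in [dirs C (x i)]. *)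
  by apply: subset_closure; exists 1; rewrite scale1r.
Unshelve. all: by end_near. Qed.
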